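(* Let $n\ge 1$ and let $T$ be the staircase $\{(i,j):1\le i<j\le n\}$ with some subset of its boxes shaded. Then $T$ is the inversions diagram of some dominant permutation in $S_n$ if and only if for every box $(i,j)$ that is the top shaded box of its column (i.e. $(i,j)$ is shaded and no $(i',j)$ with $i<i'<j$ is shaded), all the boxes in the rectangle with corners $(i,i+1),(i,j),(1,i+1),(1,j)$, i.e. all boxes $(r,c)$ with $1\le r\le i$ and $i+1\le c\le j$, are shaded.
   Context: Boxes $(i,j)$, $1\le i<j\le n$, have row index $i$ and column index $j$; rows are drawn with index increasing from bottom to top. For $w=w_1\cdots w_n\in S_n$, $\mathrm{Inv}(w)=\{(i,j): i<j,\ w_j<w_i\}$, and the inversions diagram of $w$ is the staircase in which box $(i,j)$ is shaded exactly when $(i,j)\in\mathrm{Inv}(w)$. The Lehmer code of $w$ is $(c_1,\dots,c_{n-1})$ with $c_i=\#\{j>i: (i,j)\in\mathrm{Inv}(w)\}$. A permutation is dominant if its Lehmer code is weakly decreasing; equivalently, if it avoids the pattern 132, i.e. there are no $i<j<k$ with $w_i<w_k<w_j$. *)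

(* Defs.v *)
From mathcomp Require Import all_boot all_fingroup.

Set Implicit Arguments.
Unset Strict Implicit.
Unset Printing Implicit Defensive.

(* Boxes are pairs (row, column).  The indices 1..n of the mathematics are
   0..n-1 here, both for boxes and for the values of a permutation. *)

Definition staircase (n : nat) : {set 'I_n * 'I_n} :=
  [set b : 'I_n * 'I_n | b.1 < b.2].

Definition inversions (n : nat) (w : 'S_n) : {set 'I_n * 'I_n} :=
  [set b : 'I_n * 'I_n | (b.1 < b.2) && (w b.2 < w b.1)].

(* The code has n - 1 entries: the last row index is left out. *)
Definition lehmer_code (n : nat) (w : 'S_n) : seq nat :=
  [seq #|[set j | (i, j) \in inversions w]| | i : 'I_n <- enum 'I_n & i.+1 < n].

Definition dominant (n : nat) (w : 'S_n) : bool := sorted geq (lehmer_code w).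

(* A shading of the staircase is its set of shaded boxes.  Row indices increase
   from bottom to top, so the boxes above (i, j) in column j are the (i', j)
   with i < i' < j. *)
Definition top_shaded (n : nat) (T : {set 'I_n * 'I_n}) (i j : 'I_n) : Prop :=
  (i, j) \in T /\ forall i' : 'I_n, i < i' < j -> (i', j) \notin T.

(* Main.v *)
Require Import Defs.
From mathcomp Require Import all_boot all_fingroup.

(** Write [T] for the set of shaded boxes.  Everything rests on one property of
    a diagram: [down_closed T], which says that in each column the shaded boxes
    form an initial segment starting from the bottom row.

    If [w] is dominant, its inversions are down closed
    ([dominant_down_closed]): this is the avoidance of 132.  A pattern 132
    could be moved so that its first two positions are adjacent, and the code
    would then increase strictly from the first of them to the second.
    Now let [(i, j)] be the top shaded box of column [j] and [i < c < j].  Since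
    [(c, j)] is not shaded, [w c < w j < w i], so [(i, c)] is shaded, and
    down closure fills the part of column [c] below it.

    Conversely, the rectangle condition with [c = j] makes [T] down closed, and
    with the other values of [c] it gives cotransitivity: if [(i, k)] is shaded
    and [i < j < k], then [(j, k)] is shaded or [j] lies above the top shaded box
    of column [k], in which case the rectangle contains [(i, j)].  Down closure
    also gives transitivity, and a transitive and cotransitive subset of the
    staircase is the inversion set of a permutation ([inversions_surj]).  That
    permutation is dominant since the rows of a down closed diagram decrease for
    inclusion, and hence in length. *)

Set Implicit Arguments.
Unset Strict Implicit.
Unset Printing Implicit Defensive.

(** * Dominance and the rows of the diagram *)

Definition row_length n (T : {set 'I_n * 'I_n}) (i : 'I_n) : nat :=
  #|[set j | (i, j) \in T]|.

Definition down_closed n (T : {set 'I_n * 'I_n}) : Prop :=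
  forall i j r : 'I_n, (i, j) \in T -> r <= i -> (r, j) \in T.

(** Because the order on naturals is transitive, being sorted compares all
    pairs of entries and not just consecutive ones. *)
Lemma dominantP n (w : 'S_n) :
  dominant w <->
  (forall i k : 'I_n, i < k -> k.+1 < n ->
     row_length (inversions w) k <= row_length (inversions w) i).
Proof.
rewrite /dominant /lehmer_code sorted_map.
set s := [seq i <- enum 'I_n | _]; pose F := row_length (inversions w).
have s_sorted : sorted (relpre val ltn) s.
  apply: sorted_filter; first by move=> a b c /=; apply: ltn_trans.
  by rewrite -sorted_map val_enum_ord iota_ltn_sorted.
have mem_s (i : 'I_n) : (i \in s) = (i.+1 < n) by rewrite mem_filter mem_enum andbT.
split=> [F_sorted i k lt_ik k_ok | F_mono].
  have i_ok : i.+1 < n by apply: ltn_trans k_ok.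
  have lt_index : index i s < index k s.
    rewrite ltnNge; apply/negP => le_index.
    have: (k <= i)%N.
      apply: (@sorted_leq_index _ (relpre val leq) _ _ s); rewrite ?mem_s //.
      - by move=> a b c /=; apply: leq_trans.
      - by move=> a /=.
      - by apply: sub_sorted s_sorted => a b /=; apply: ltnW.
    by rewrite leqNgt lt_ik.
  have := @sorted_ltn_index _ (relpre F geq) _ s F_sorted i k.
  rewrite !mem_s; apply=> //.
  by move=> a b c /= le_ab le_ca; apply: leq_trans le_ca le_ab.
pose in_code (i : 'I_n) := i.+1 < n.
apply: (@sub_in_sorted _ in_code (relpre val ltn) _ _ _ _ s_sorted).
  by move=> i k _ k_ok lt_ik; apply: F_mono.
exact: filter_all.
Qed.

Lemma inversionsE n (w : 'S_n) (i j : 'I_n) :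
  ((i, j) \in inversions w) = (i < j) && (w j < w i).
Proof. by rewrite inE. Qed.

(** If [w p < w j < w q] with [q] right after [p], then each inversion [(p, k)]
    gives an inversion [(q, k)], and [(q, j)] is one more, so the code increases
    from [p] to [q]. *)
Lemma dominant_adjacent n (w : 'S_n) (p q j : 'I_n) :
  dominant w -> q = p.+1 :> nat ->
  (q, j) \in inversions w -> (p, j) \in inversions w.
Proof.
move=> /dominantP w_dom qE inv_qj; move: (inv_qj); rewrite inversionsE.
case/andP=> lt_qj lt_wj.
have lt_pj : p < j by rewrite (leq_trans _ lt_qj) ?qE.
rewrite inversionsE lt_pj /= ltnNge; apply/negP => le_w.
have lt_pq : p < q by rewrite qE.
have := w_dom p q lt_pq (leq_ltn_trans lt_qj (ltn_ord j)).
rewrite leqNgt => /negP; apply; apply: proper_card; apply/properP; split.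
  apply/subsetP => k; rewrite !in_set /= => /andP[lt_pk lt_wk].
  have lt_wkq : w k < w q.
    by apply: ltn_trans lt_wk _; apply: leq_ltn_trans lt_wj.
  rewrite lt_wkq andbT ltn_neqAle {2}qE lt_pk andbT.
  by apply: contraTneq lt_wkq => /val_inj->; rewrite ltnn.
exists j; first by rewrite in_set.
by rewrite !in_set /= lt_pj -leqNgt.
Qed.

Lemma dominant_down_closed n (w : 'S_n) :
  dominant w -> down_closed (inversions w).
Proof.
move=> w_dom i j r inv_ij le_ri.
have [d] := ubnP (i - r); elim: d => // d IHd in r le_ri *.
move: le_ri; rewrite leq_eqVlt => /predU1P[/val_inj-> // | lt_ri] lt_d.
have r1_ok : r.+1 < n := leq_ltn_trans lt_ri (ltn_ord i).
apply: (@dominant_adjacent _ _ _ (Ordinal r1_ok)) => //.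
apply: IHd => //=.
by rewrite -ltnS (leq_trans _ lt_d) // ltnS ltn_sub2l.
Qed.

Lemma down_closed_dominant n (w : 'S_n) :
  down_closed (inversions w) -> dominant w.
Proof.
move=> w_down; apply/dominantP => i k lt_ik _; apply: subset_leq_card.
apply/subsetP => j; rewrite [_ \in _]in_set => inv_kj.
by rewrite in_set (w_down k) // ltnW.
Qed.

(** * Recognising inversion sets *)

Section InversionSets.

Variables (n : nat) (T : {set 'I_n * 'I_n}).
Hypothesis T_stair : T \subset staircase n.
Hypothesis T_trans : forall i j k : 'I_n,
  (i, j) \in T -> (j, k) \in T -> (i, k) \in T.
Hypothesis T_cotrans : forall i j k : 'I_n,
  i < j < k -> (i, k) \in T -> ((i, j) \in T) || ((j, k) \in T).

(** [before k i] is what [w k < w i] must amount to if [w] has inversion set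
    [T]. *)
Let before (k i : 'I_n) : bool :=
  if k < i then (k, i) \notin T else (i, k) \in T.

Let box_lt (i j : 'I_n) : (i, j) \in T -> i < j.
Proof. by move/(subsetP T_stair); rewrite inE. Qed.

Let before_irr : irreflexive before.
Proof.
by move=> i; rewrite /before ltnn; apply/negP => /box_lt; rewrite ltnn.
Qed.

Let before_total (i k : 'I_n) : i != k -> before i k || before k i.
Proof.
rewrite /before; case: ltngtP => [lt_ik|lt_ki|/val_inj->] //.
- by rewrite orNb.
- by rewrite orbN.
by rewrite eqxx.
Qed.

Let before_asym (i k : 'I_n) : before i k -> ~~ before k i.
Proof.
rewrite /before; case: ltngtP => [lt_ik|lt_ki|/val_inj->] //.
- by rewrite negbK.
by move=> /box_lt; rewrite ltnn.
Qed.

(** A total asymmetric relation without cyclic triples is transitive.  For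
    indices [a < b < c], a cycle through [a], [b], [c] in this order would violate
    cotransitivity of [T], and a cycle in the opposite order its transitivity. *)
Let before_trans : transitive before.
Proof.
have no_cycle (a b c : 'I_n) : a < b -> b < c ->
    ~~ [&& before a b, before b c & before c a] /\
    ~~ [&& before b a, before c b & before a c].
  move=> lt_ab lt_bc; have lt_ac := ltn_trans lt_ab lt_bc.
  rewrite /before lt_ab lt_bc lt_ac.
  rewrite !(leq_gtF (ltnW lt_ab), leq_gtF (ltnW lt_bc), leq_gtF (ltnW lt_ac)).
  split.
    apply/and3P=> [[Nab Nbc ac]].
    have := @T_cotrans a b c _ ac.
    by rewrite lt_ab lt_bc (negPf Nab) (negPf Nbc) => /(_ isT).
  by apply/and3P=> [[ab bc /negP[]]]; apply: T_trans bc.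
move=> b a c bef_ab bef_bc; apply: contraT => Nbef_ac.
have neq_ac : a != c.
  by apply: contraTneq bef_ab => ->; apply: before_asym.
have bef_ca : before c a.
  by have := before_total neq_ac; rewrite (negPf Nbef_ac).
have neq x y : before x y -> x != y :> nat.
  by move=> bef; apply: contraTneq bef => /val_inj->; rewrite before_irr.
move: (neq _ _ bef_ab) (neq _ _ bef_bc) (neq _ _ bef_ca).
case: (ltngtP a b) => // lt1 _; case: (ltngtP b c) => // lt2 _;
  case: (ltngtP c a) => // lt3 _.
- by have := ltn_trans (ltn_trans lt1 lt2) lt3; rewrite ltnn.
- by case: (no_cycle a b c lt1 lt2); rewrite bef_ab bef_bc bef_ca.
- by case: (no_cycle c a b lt3 lt1); rewrite bef_ab bef_bc bef_ca.
- by case: (no_cycle a c b lt3 lt2); rewrite bef_ab bef_bc bef_ca.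
- by case: (no_cycle b c a lt2 lt3); rewrite bef_ab bef_bc bef_ca.
- by case: (no_cycle b a c lt1 lt3); rewrite bef_ab bef_bc bef_ca.
- by case: (no_cycle c b a lt2 lt1); rewrite bef_ab bef_bc bef_ca.
- by have := ltn_trans (ltn_trans lt1 lt3) lt2; rewrite ltnn.
Qed.

(** The permutation sends each index to its rank in the total order [before]. *)
Lemma inversions_surj : exists w : 'S_n, inversions w = T.
Proof.
pose rank i := #|[set k | before k i]|.
have rank_lt i : rank i < n.
  rewrite -[X in _ < X]card_ord -cardsT; apply/proper_card/properP.
  by split; [exact: subsetT | exists i; rewrite ?inE ?before_irr].
have rank_mono k i : before k i -> rank k < rank i.
  move=> bef_ki; apply/proper_card/properP; split.
    by apply/subsetP => j; rewrite !inE => /before_trans; apply.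
  by exists k; rewrite inE ?before_irr.
have rankE k i : (rank k < rank i) = before k i.
  apply/idP/idP => [lt_rank|]; last exact: rank_mono.
  have neq_ki : k != i by apply: contraTneq lt_rank => ->; rewrite ltnn.
  case/orP: (before_total neq_ki) => // /rank_mono.
  by rewrite ltnNge (ltnW lt_rank).
have w_inj : injective (fun i => Ordinal (rank_lt i)).
  move=> i k /(congr1 val)/= eq_rank; apply: contraTeq isT.
  by move/before_total; rewrite -!rankE eq_rank ltnn.
exists (perm w_inj); apply/setP => -[i j]; rewrite inversionsE !permE /= rankE.
rewrite /before; case: (ltngtP i j) => //= [lt_ji|/val_inj eq_ij];
  by apply/esym/negP => /box_lt; rewrite ?eq_ij ?ltnn // ltnNge ltnW.
Qed.

End InversionSets.

(** * The rectangle condition *)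

Definition rectangles_shaded n (T : {set 'I_n * 'I_n}) : Prop :=
  forall i j : 'I_n, top_shaded T i j ->
    forall r c : 'I_n, r <= i -> i < c <= j -> (r, c) \in T.

Lemma top_shaded_above n (T : {set 'I_n * 'I_n}) (i j : 'I_n) :
  (i, j) \in T -> exists2 m : 'I_n, i <= m & top_shaded T m j.
Proof.
move=> Tij; case: (@arg_maxnP _ i (fun m => (m, j) \in T) val Tij) => m Tmj m_max.
exists m; first exact: m_max.
split=> // k /andP[lt_mk _]; apply: contraL lt_mk => /m_max.
by rewrite -leqNgt.
Qed.

Section Rectangles.

Variables (n : nat) (T : {set 'I_n * 'I_n}).
Hypothesis T_stair : T \subset staircase n.
Hypothesis T_rect : rectangles_shaded T.

Lemma rectangles_down_closed : down_closed T.
Proof.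
move=> i j r /top_shaded_above[m le_im top_m] le_ri.
apply: (T_rect top_m); first exact: leq_trans le_im.
by have := subsetP T_stair _ top_m.1; rewrite inE leqnn andbT.
Qed.

Lemma rectangles_trans (i j k : 'I_n) :
  (i, j) \in T -> (j, k) \in T -> (i, k) \in T.
Proof.
move=> /(subsetP T_stair); rewrite inE /= => lt_ij Tjk.
by apply: rectangles_down_closed Tjk _; apply: ltnW.
Qed.

Lemma rectangles_cotrans (i j k : 'I_n) :
  i < j < k -> (i, k) \in T -> ((i, j) \in T) || ((j, k) \in T).
Proof.
case/andP=> _ lt_jk /top_shaded_above[m le_im top_m].
have [le_jm | lt_mj] := leqP j m.
  by rewrite (rectangles_down_closed top_m.1 le_jm) orbT.
by rewrite (T_rect top_m le_im) // lt_mj ltnW.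
Qed.

End Rectangles.

Lemma dominant_rectangles n (w : 'S_n) :
  dominant w -> rectangles_shaded (inversions w).
Proof.
move=> w_dom i j [inv_ij top_i] r c le_ri /andP[lt_ic].
apply: contraTT => Nrc; rewrite -ltnNge ltn_neqAle.
have Nic : (i, c) \notin inversions w.
  by apply: contra Nrc => /dominant_down_closed; apply.
have neq_jc : j != c by apply: contraTneq inv_ij => ->.
rewrite (inj_eq val_inj) neq_jc /= leqNgt; apply/negP => lt_cj.
move: inv_ij Nic (top_i c); rewrite !inversionsE lt_ic lt_cj /= -!leqNgt.
case/andP=> _ lt_wji le_wic /(_ isT) le_wcj.
by have := leq_trans le_wic le_wcj; rewrite leqNgt lt_wji.
Qed.

Theorem proposition4p6 (n : nat) (n_gt0 : 0 < n) (T : {set 'I_n * 'I_n})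
    (T_shading : T \subset staircase n) :
  (exists w : 'S_n, dominant w /\ inversions w = T) <->
  (forall i j : 'I_n, top_shaded T i j ->
     forall r c : 'I_n, r <= i -> i < c <= j -> (r, c) \in T).
Proof.
split=> [[w [w_dom <-]] | T_rect]; first exact: dominant_rectangles.
have [w wE] := inversions_surj T_shading (rectangles_trans T_shading T_rect)
  (rectangles_cotrans T_shading T_rect).
exists w; split=> //; apply: down_closed_dominant; rewrite wE.
exact: rectangles_down_closed.
Qed.
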